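(* Let $U_\beta\subset\mathbb R^m$ be open, $\delta>0$, $M=U_\beta\times(-\delta,\delta)$ with points $(\beta,\lambda)$, $s(\beta,\lambda)=(\beta,-\lambda)$, and $F=U_\beta\times\{0\}$. Let $$R=\Delta_M\cup\Gamma_s\subset M\times M$$ be the orbit equivalence relation, where $\Delta_M$ is the diagonal and $\Gamma_s$ the graph of $s$. Then $R$ is not a $C^1$ embedded submanifold of $M\times M$ at points lying over $F$. Hence the quotient of $M$ by the reflection $s$ is not a regular quotient in the sense of Godement at the fixed locus $F$.
   Context: Godement's criterion: an equivalence relation on a manifold $M$ defines a smooth quotient for which the canonical projection is a submersion (a regular quotient) only if its graph in $M\times M$ is an embedded submanifold and the projection of that graph onto $M$ is a submersion. ''Points lying over $F$'' are the points $(x,x)\in R$ with $x\in F$. *)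

(* Defs.v *)
From mathcomp Require Import all_boot all_order all_algebra.
From mathcomp Require Import all_classical all_reals all_analysis.

Set Implicit Arguments.
Unset Strict Implicit.
Unset Printing Implicit Defensive.

Import Order.TTheory GRing.Theory Num.Theory.
Import numFieldNormedType.Exports.
Local Open Scope classical_set_scope.
Local Open Scope ring_scope.

(* To be used with [A] open and [V] finite-dimensional: then continuity of
   [x |-> 'd f x v] for each fixed [v] is continuity of [x |-> 'd f x] for the
   operator norm, and this is the usual class C^k. *)
Fixpoint Ck (R : realType) (V W : normedModType R) (k : nat) (A : set V)
    (f : V -> W) : Prop :=
  if k is k'.+1 then
    (forall x, A x -> differentiable f x) /\
    (forall v : V, Ck k' A (fun x => 'd f x v))
  else forall x, A x -> {for x, continuous f}.

(* Smoothness classes: [Some k] stands for C^k and [None] for C^oo. *)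
Definition Cr (R : realType) (V W : normedModType R) (r : option nat)
    (A : set V) (f : V -> W) : Prop :=
  if r is Some k then Ck k A f else forall k, Ck k A f.

Definition diffeo (R : realType) (V W : normedModType R) (r : option nat)
    (A : set V) (B : set W) (f : V -> W) (g : W -> V) : Prop :=
  [/\ open A, open B, Cr r A f & Cr r B g] /\
  [/\ forall x, A x -> B (f x), forall y, B y -> A (g y),
      forall x, A x -> g (f x) = x & forall y, B y -> f (g y) = y].

(* [S] is, in a neighbourhood of [p], an embedded C^r submanifold of the open
   set [N] of [V]: there is a slice chart around [p], onto an open subset of
   R^k x R^l, in which [S] is given by the vanishing of the last l coordinates.
   The dimension k is not prescribed. *)
Definition embedded_submanifold_at (R : realType) (V : normedModType R)
    (r : option nat) (N S : set V) (p : V) : Prop :=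
  exists (k l : nat) (A : set V) (B : set ('rV[R]_k * 'rV[R]_l)%type)
         (phi : V -> 'rV[R]_k * 'rV[R]_l) (psi : 'rV[R]_k * 'rV[R]_l -> V),
    [/\ A p, A `<=` N, diffeo r A B phi psi &
        forall q, A q -> (S q <-> (phi q).2 = 0)].

(* A chart is only meaningful on [chart_dom]; its inverse, only on the image
   of [chart_dom]. *)
Record chart (R : realType) (d : nat) (Q : Type) := Chart {
  chart_dom : set Q ;
  chart_map :> Q -> 'rV[R]_d ;
  chart_inv : 'rV[R]_d -> Q }.

Definition chart_img (R : realType) (d : nat) (Q : Type) (c : chart R d Q) :
  set 'rV[R]_d := c @` chart_dom c.

Definition is_chart (R : realType) (d : nat) (Q : topologicalType)
    (c : chart R d Q) : Prop :=
  [/\ open (chart_dom c), open (chart_img c),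
      forall q, chart_dom c q -> {for q, continuous c},
      forall y, chart_img c y -> {for y, continuous (chart_inv c)} &
      forall q, chart_dom c q -> chart_inv c (c q) = q].

Definition is_atlas (R : realType) (d : nat) (Q : topologicalType)
    (r : option nat) (A : set (chart R d Q)) : Prop :=
  [/\ forall c, A c -> is_chart c,
      forall q, exists2 c, A c & chart_dom c q &
      forall c c', A c -> A c' ->
        Cr r (c @` (chart_dom c `&` chart_dom c')) (c' \o chart_inv c)].

Definition is_manifold (R : realType) (d : nat) (Q : topologicalType)
    (r : option nat) (A : set (chart R d Q)) : Prop :=
  [/\ hausdorff_space Q, @second_countable Q & is_atlas r A].

(* C^r submersion from the open subset [M] of [V] to the manifold [Q]; only the
   values of [pi] on [M] matter. *)
Definition is_submersion (R : realType) (V : normedModType R) (d : nat)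
    (Q : topologicalType) (r : option nat) (M : set V)
    (A : set (chart R d Q)) (pi : V -> Q) : Prop :=
  (forall x, M x -> {for x, continuous pi}) /\
  (forall c, A c ->
     let D := M `&` pi @^-1` chart_dom c in
     Cr r D (c \o pi) /\
     (forall x, D x -> forall w, exists v, 'd (c \o pi) x v = w)).

(* The set [Q] with the map [pi] is the quotient of [M] by the equivalence
   relation of graph [E]. *)
Definition is_quotient (V Q : Type) (M : set V) (E : set (V * V))
    (pi : V -> Q) : Prop :=
  (forall q, exists2 x, M x & pi x = q) /\
  (forall x y, M x -> M y -> (pi x = pi y <-> E (x, y))).

(* The quotient of [M] by [E] carries a structure of C^r manifold, of some
   dimension d, for which the canonical projection is a submersion. *)
Definition regular_quotient (R : realType) (V : normedModType R)
    (r : option nat) (M : set V) (E : set (V * V)) : Prop :=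
  exists (Q : topologicalType) (pi : V -> Q) (d : nat)
         (A : set (chart R d Q)),
    [/\ is_quotient M E pi, is_manifold r A & is_submersion r M A pi].

(* Regularity of the quotient near the class of [x]: some saturated open
   neighbourhood of [x] in [M] has a regular quotient. *)
Definition regular_quotient_at (R : realType) (V : normedModType R)
    (r : option nat) (M : set V) (E : set (V * V)) (x : V) : Prop :=
  exists W : set V,
    [/\ open W, W x, W `<=` M,
        forall y z, W y -> E (y, z) -> W z &
        regular_quotient r W E].

Definition graph_on (V : Type) (M : set V) (f : V -> V) : set (V * V) :=
  [set p | M p.1 /\ p.2 = f p.1].

Definition reflection (R : realType) (m : nat) (p : 'rV[R]_m * R) :
  'rV[R]_m * R := (p.1, - p.2).

(* Main.v *)
Require Import Defs.
From HB Require Import structures.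
From mathcomp Require Import all_boot all_order all_algebra.
From mathcomp Require Import all_classical all_reals all_analysis.
From mathcomp Require Import ring lra.

Set Implicit Arguments.
Unset Strict Implicit.
Unset Printing Implicit Defensive.

Import Order.TTheory GRing.Theory Num.Theory.
Import numFieldNormedType.Exports.
Local Open Scope classical_set_scope.
Local Open Scope ring_scope.

(** The two halves rest on two different obstructions at a point [x] of the
    fixed locus. Write [e] for the direction of the lambda axis.

    The relation is not embedded at [(x, x)]. The velocities at a point of the
    curves lying in an embedded submanifold form a vector space: a slice chart
    identifies them with the kernel of a linear map ([tangentD]). The diagonal
    contains a curve of velocity [(e, e)] and the graph of the reflection one of
    velocity [(e, -e)], so some curve in the relation would have velocity
    [(2e, 0)]. This is impossible: the lambda coordinates of two related points
    have equal squares, and this passes to their velocities ([eq_sqr_derive]).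

    The quotient is not regular at [x]. This is shown directly, without passing
    through Godement's criterion. Read in a chart of the quotient, the projection is a C^1
    submersion [f], and [f (x + t e) = f (x - t e)] forces [e] into the kernel
    of its differential at [x]. A C^1 submersion whose differential has a
    nonzero kernel takes its value at [x] at other points arbitrarily close to
    [x] ([noninjective_submersion]), by the usual Newton-type contraction behind
    the implicit function theorem. But [x] is alone in its class
    ([folded_not_regular]). *)

(** * Derivatives of curves *)

Lemma is_derive_comp_diff (R : realType) (V W : normedModType R)
    (c : R -> V) (f : V -> W) (t : R) (v : V) :
  is_derive t 1 c v -> differentiable f (c t) ->
  is_derive t 1 (f \o c) ('d f (c t) v).
Proof.
move=> c'v df; have dc : differentiable c t by apply/derivable1_diffP.
have dfc : differentiable (f \o c) t by exact: differentiable_comp.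
apply: DeriveDef; first exact: diff_derivable.
by rewrite deriveE// diff_comp//= -[in RHS](@derive_val _ _ _ _ _ _ _ c'v) deriveE.
Qed.

Lemma is_derive_line (R : realType) (V : normedModType R) (x v : V) (t : R) :
  is_derive t 1 (fun s => x + s *: v) v.
Proof.
have H : is_derive t 1 ( *:%R ^~ v) v.
  apply: DeriveDef; first exact/diff_derivable.
  by rewrite deriveE// diff_val scale1r.
by apply: is_derive_eq; rewrite add0r.
Qed.

Lemma near_line (R : realType) (V : normedModType R) (x v : V) (P : set V) :
  nbhs x P -> \forall t \near (0 : R), P (x + t *: v).
Proof.
have : {for (0 : R), continuous (fun t : R => x + t *: v)}.
  apply/differentiable_continuous/derivable1_diffP.
  by have [] := is_derive_line x v 0.
by move=> /[swap] xP; apply; rewrite scale0r addr0.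
Qed.

Lemma is_derive_fst (R : realType) (V W : normedModType R)
    (c : R -> (V * W)%type) (t : R) (v : V * W) :
  is_derive t 1 c v -> is_derive t 1 (fun s => (c s).1) v.1.
Proof.
move=> c'; pose f := @fst V W : {linear (V * W)%type -> V}.
have fc : continuous f by move=> z; exact: cvg_fst.
have -> : v.1 = 'd f (c t) v by rewrite diff_lin.
exact/is_derive_comp_diff/linear_differentiable.
Qed.

Lemma is_derive_snd (R : realType) (V W : normedModType R)
    (c : R -> (V * W)%type) (t : R) (v : V * W) :
  is_derive t 1 c v -> is_derive t 1 (fun s => (c s).2) v.2.
Proof.
move=> c'; pose f := @snd V W : {linear (V * W)%type -> W}.
have fc : continuous f by move=> z; exact: cvg_snd.
have -> : v.2 = 'd f (c t) v by rewrite diff_lin.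
exact/is_derive_comp_diff/linear_differentiable.
Qed.

(** Differentiating [a ^+ 2 = b ^+ 2] once gives only [0 = 0]; the information is
    in the second order, where [t^-2 * (a t)^2] tends to the square of the
    derivative. *)
Lemma eq_sqr_derive (R : realType) (a b : R -> R) (a' b' : R) :
  is_derive (0 : R) 1 a a' -> is_derive (0 : R) 1 b b' -> a 0 = 0 -> b 0 = 0 ->
  (\forall t \near (0 : R), a t ^+ 2 = b t ^+ 2) -> a' ^+ 2 = b' ^+ 2.
Proof.
move=> da db a0 b0 ab.
have sqr_lim (g : R -> R) g' : is_derive (0 : R) 1 g g' -> g 0 = 0 ->
    t^-1 ^+ 2 * g t ^+ 2 @[t --> 0^'] --> g' ^+ 2.
  move=> [g_ex <-] g0.
  have gq : t^-1 * g t @[t --> 0^'] --> 'D_1 g 0.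
    move: g_ex => /cvg_ex[l gl].
    rewrite /derive (cvg_lim _ gl)//.
    apply: cvg_trans gl; apply: near_eq_cvg; near=> t.
    by rewrite /= g0 subr0 addr0 [_%:A]mulr1.
  rewrite expr2; under eq_fun do rewrite -exprMn expr2.
  exact: cvgM.
apply: (cvg_unique (@norm_hausdorff _ _) (sqr_lim _ _ da a0)).
apply: cvg_trans (sqr_lim _ _ db b0).
apply: near_eq_cvg; apply: cvg_within.
by apply: filterS ab => t ->.
Unshelve. all: by end_near.
Qed.

(** * Tangent vectors of embedded submanifolds *)

Lemma Ck_continuous (R : realType) (V W : normedModType R) (k : nat)
    (A : set V) (f : V -> W) :
  Ck k A f -> forall x, A x -> {for x, continuous f}.
Proof.
case: k => [//|k] [df _] x Ax.
exact/differentiable_continuous/df.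
Qed.

Lemma Cr_ge1 (R : realType) (V W : normedModType R) (r : option nat)
    (A : set V) (f : V -> W) :
  r <> Some 0%N -> Cr r A f ->
  (forall x, A x -> differentiable f x) /\
  (forall v x, A x -> {for x, continuous (fun y => 'd f y v)}).
Proof.
case: r => [[//|k] _ [df cdf]|_ /(_ 1%N)[]//].
by split=> // v; exact: Ck_continuous (cdf v).
Qed.

(** For an embedded submanifold this is membership in the tangent space; for a
    union of two submanifolds the vectors obtained form only a cone. *)
Definition tangent (R : realType) (V : normedModType R) (S : set V) (p w : V) :=
  exists c : R -> V,
    [/\ c 0 = p, \forall t \near 0, S (c t) & is_derive (0 : R) 1 c w].

(** In a slice chart [phi], the velocity [u] of a curve in [S] satisfies
    [('d phi p u).2 = 0], a linear condition. Conversely, if [u] satisfies it, the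
    straight segment from [phi p] in the direction ['d phi p u] stays in the slice,
    and its preimage is a curve in [S] with velocity [u], since ['d psi] inverts
    ['d phi]. *)
Lemma tangentD (R : realType) (V : normedModType R) (r : option nat)
    (N S : set V) (p v w : V) :
  r <> Some 0%N -> embedded_submanifold_at r N S p ->
  tangent S p v -> tangent S p w -> tangent S p (v + w).
Proof.
move=> r0 [k [l [A [B [phi [psi [Ap _ [[oA oB Cphi Cpsi] [AB BA phiK psiK]] AS]]]]]]].
have [dphi _] := Cr_ge1 r0 Cphi.
have [dpsi _] := Cr_ge1 r0 Cpsi.
have flat u : tangent S p u -> (phi p).2 = 0 /\ ('d phi p u).2 = 0.
  move=> [c [c0 Sc c'u]].
  have Ac : \forall t \near (0 : R), A (c t).
    have /differentiable_continuous cc : differentiable c 0.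
      exact/derivable1_diffP.
    by apply: cc; rewrite c0; exact: open_nbhs_nbhs.
  have phic0 : \forall t \near (0 : R), (phi (c t)).2 = 0.
    by near=> t; apply/(AS (c t)); [near: t|near: t].
  split; first by have := nbhs_singleton phic0; rewrite c0.
  have d1 : is_derive (0 : R) 1 (phi \o c) ('d phi p u).
    by rewrite -c0; apply: is_derive_comp_diff => //; rewrite c0; exact: dphi.
  have d2 : is_derive (0 : R) 1 (snd \o (phi \o c)) ('d phi p u).2.
    exact: is_derive_snd d1.
  have d3 : is_derive (0 : R) 1 (cst 0) ('d phi p u).2.
    exact: near_eq_is_derive d2.
  by rewrite -(@derive_val _ _ _ _ _ _ _ d3) derive_cst.
move=> /flat[phip0 v0] /flat[_ w0].
pose u := v + w.
have u0 : ('d phi p u).2 = 0.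
  by rewrite linearD -[LHS]/(('d phi p v).2 + ('d phi p w).2) v0 w0 addr0.
exists (psi \o (fun t => phi p + t *: 'd phi p u)).
have Bp : B (phi p) by exact: AB.
have dphip : differentiable phi p by exact: dphi.
have dpsip : differentiable psi (phi p) by exact: dpsi.
split.
- by rewrite /= scale0r addr0 phiK.
- have : \forall t \near (0 : R), B (phi p + t *: 'd phi p u).
    by apply: near_line; exact: open_nbhs_nbhs.
  apply: filterS => t Bt; apply/AS; first exact: BA.
  by rewrite /= psiK//= phip0 u0 scaler0 addr0.
- have := @is_derive_comp_diff _ _ _ (fun t : R => phi p + t *: 'd phi p u) psi 0 _
     (is_derive_line (phi p) ('d phi p u) 0).
  rewrite scale0r addr0 => /(_ dpsip).
  suff -> : 'd psi (phi p) ('d phi p u) = u by [].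
  have -> : 'd psi (phi p) ('d phi p u) = 'd (psi \o phi) p u.
    by rewrite (diff_comp dphip dpsip).
  rewrite -deriveE; last exact: differentiable_comp.
  rewrite (@near_eq_derive _ _ _ _ id) ?derive_id//.
  by near=> y; rewrite /= phiK//; near: y; exact: open_nbhs_nbhs.
Unshelve. all: by end_near.
Qed.

(** * Submersions with a nontrivial kernel are not injective *)

Lemma rV_coord_le_norm (R : realType) (d : nat) (w : 'rV[R]_d) (j : 'I_d) :
  `|w 0 j| <= `|w|.
Proof.
rewrite [leRHS]/Num.Def.normr/= mx_normrE.
exact: (le_bigmax _ (fun i : 'I_1 * 'I_d => `|w i.1 i.2|) (0, j)).
Qed.

(** The norm is the maximum of the coordinates, so the scalar mean value theorem
    applied to each coordinate suffices. *)
Lemma mean_value_inequality (R : realType) (d : nat) (h dh : R -> 'rV[R]_d)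
    (K : R) :
  (forall t : R, 0 <= t <= 1 -> is_derive t 1 h (dh t)) ->
  (forall t : R, 0 <= t <= 1 -> `|dh t| <= K) ->
  `|h 1 - h 0| <= K.
Proof.
move=> h' dhK.
have K0 : 0 <= K by rewrite (le_trans _ (dhK 0 _))// lexx ler01.
rewrite [leLHS]/Num.Def.normr/= mx_normrE (bigmax_le _ K0)//= => -[i j] _ /=.
rewrite ord1 !mxE.
have h'j (t : R) : 0 <= t <= 1 -> is_derive t 1 (fun s => h s 0 j) (dh t 0 j).
  move=> t01; have ht := h' _ t01.
  apply: DeriveDef; first exact: (derivable_mxP _ _ _).1.
  by rewrite -(@derive_val _ _ _ _ _ _ _ ht) derive_mx// mxE.
have [] := @MVT_segment R (fun s => h s 0 j) (fun s => dh s 0 j) 0 1 ler01.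
- move=> t; rewrite in_itv/= => /andP[t0 t1].
  by apply: h'j; rewrite !ltW.
- apply: derivable_within_continuous => t; rewrite in_itv/= => t01.
  by have := h'j _ t01; case.
- move=> t; rewrite in_itv/= => t01 ->.
  by rewrite subr0 mulr1 (le_trans (rV_coord_le_norm _ _))// dhK.
Qed.

(** The space of row vectors bundled with both its norm and its completeness, the
    form in which the Banach fixed point theorem takes it. *)
Definition rV_complete (R : realType) (d : nat) : completeNormedModType R :=
  HB.pack 'rV[R]_d (Uniform_isComplete.Build 'rV[R]_d (@cauchy_cvg _)).

(** The bound on [g 0] together with the contraction factor 1/2 keeps the ball
    stable: the image of [u] has norm at most [rho / 2 + rho / 2]. *)
Lemma contraction_ball_fixpoint (R : realType) (d : nat)
    (g : 'rV[R]_d -> 'rV[R]_d) (rho : R) :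
  0 < rho -> `|g 0| <= rho / 2 ->
  (forall u v, `|u| <= rho -> `|v| <= rho -> `|g u - g v| <= 2^-1 * `|u - v|) ->
  exists2 u, `|u| <= rho & g u = u.
Proof.
move=> rho0 g0 glip.
pose X := rV_complete R d.
pose B : set X := [set u | `|u| <= rho].
have gB : set_fun B B (g : X -> X).
  move=> u; rewrite /B/= => uB.
  have B0 : `|0 : 'rV[R]_d| <= rho by rewrite normr0 ltW.
  have := glip _ _ uB B0; rewrite subr0 => gu.
  rewrite -(subrK (g 0) (g u)) (le_trans (ler_normD _ _))//.
  lra.
pose G : {fun B >-> B} := HB.pack (g : X -> X) (isFun.Build X X B B g gB).
have [|||u uB ug] := @banach_fixed_point R X B G.
- have h0 : 0 <= 2^-1 :> R by rewrite invr_ge0.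
  exists (NngNum h0); split; first by rewrite /= invf_lt1// ltr1n.
  by move=> [u v] [/= uB vB]; exact: glip.
- have -> : B = (fun u : X => `|u|) @^-1` [set r | r <= rho] by [].
  apply: preimage_closed; last exact: closed_le.
  by move=> u _; exact: norm_continuous.
- by exists 0; rewrite /B/= normr0 ltW.
by exists u => //.
Qed.

(** Let [L] be a linear section of ['d f x]. For small [t != 0], solve
    [f (x + t e + L u) = f x] for [u]: the map [u |-> u - (f (x + t e + L u) - f x)]
    has small derivative because ['d f z (L w)] is close to ['d f x (L w) = w] for
    [z] near [x], so it has a fixed point in a small ball. The solution differs
    from [x], since [t e] lies in the kernel of ['d f x] whereas the image of [L]
    meets that kernel only in 0. *)
Lemma noninjective_submersion (R : realType) (V : normedModType R) (d : nat)
    (f : V -> 'rV[R]_d) (A : set V) (x e : V) :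
  nbhs x A -> (forall z, A z -> differentiable f z) ->
  (forall v, {for x, continuous (fun z => 'd f z v)}) ->
  (forall w, exists v, 'd f x v = w) ->
  'd f x e = 0 -> e != 0 ->
  exists z, [/\ A z, z != x & f z = f x].
Proof.
move=> xA df cdf sdf dfe e0.
have [v dfv] := choice (fun j => sdf (delta_mx 0 j)).
pose L (u : 'rV[R]_d) := \sum_j u 0 j *: v j.
have LB u u' : L u - L u' = L (u - u').
  by rewrite -sumrB; apply: eq_bigr => j _; rewrite !mxE scalerBl.
have dfL z u : 'd f z (L u) = \sum_j u 0 j *: 'd f z (v j).
  by rewrite linear_sum; apply: eq_bigr => j _; rewrite linearZ.
have dfxL u : 'd f x (L u) = u.
  by rewrite dfL [RHS]row_sum_delta; apply: eq_bigr => j _; rewrite dfv.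
pose C := \sum_j `|v j|.
have C0 : 0 <= C by exact: sumr_ge0.
have L_le u : `|L u| <= C * `|u|.
  rewrite (le_trans (ler_norm_sum _ _ _))// mulr_suml ler_sum// => j _.
  by rewrite normrZ mulrC ler_wpM2l// rV_coord_le_norm.
(* the sum over the d basis directions of errors eps is to be at most 1/2, also for d = 0 *)
pose eps : R := (2 * d.+1%:R)^-1.
have eps0 : 0 < eps by rewrite invr_gt0 mulr_gt0// ltr0n.
have : \forall z \near x, A z /\ forall j, `|'d f z (v j) - 'd f x (v j)| < eps.
  near=> z; split; first by near: z.
  move=> j; rewrite distrC; move: j; near: z; apply: filter_forall => j.
  exact: (cvgrPdist_lt _ _).1 (cdf (v j)) _ eps0.
move=> /nbhs_ballP[r /= r0 rA].
have dfd z w : ball x r z -> `|w - 'd f z (L w)| <= 2^-1 * `|w|.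
  move=> /rA[_ zeps]; rewrite -[X in X - _]dfxL !dfL -sumrB.
  rewrite (le_trans (ler_norm_sum _ _ _))//.
  apply: (@le_trans _ _ (\sum_(j < d) `|w| * eps)).
    apply: ler_sum => j _; rewrite -scalerBr normrZ distrC.
    by rewrite ler_pM// ?rV_coord_le_norm// ltW.
  rewrite sumr_const card_ord -mulrnAr mulrC ler_wpM2r// -[leLHS]mulr_natr.
  rewrite /eps invfM -mulrA ler_piMr ?invr_ge0//.
  by rewrite ler_pdivrMl ?ltr0n// mulr1 ler_nat.
(* both parts of t e + L u are to stay shorter than r / 2 when |u| <= rho *)
pose rho := r / (2 * (C + 1)).
have rho0 : 0 < rho by rewrite divr_gt0// mulr_gt0// ltr_wpDl.
have L_lt u : `|u| <= rho -> `|L u| < r / 2.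
  move=> urho; rewrite (le_lt_trans (L_le u))//.
  apply: (@le_lt_trans _ _ (C * rho)); first by rewrite ler_wpM2l.
  rewrite /rho mulrA ltr_pdivrMr ?mulr_gt0// ?ltr_wpDl//.
  have -> : r / 2 * (2 * (C + 1)) = (C + 1) * r by field.
  by rewrite ltr_pM2r// ltrDl.
have [t [t0 te ft]] : exists t : R,
    [/\ t != 0, `|t *: e| < r / 2 & `|f (x + t *: e) - f x| <= rho / 2].
  have fc : {for x, continuous f}.
    exact/differentiable_continuous/df/(nbhs_singleton xA).
  near (0 : R)^' => t; exists t; split.
  - by near: t; exact: nbhs_dnbhs_neq.
  - have -> : `|t *: e| = `|x - (x + t *: e)| by rewrite opprD addNKr normrN.
    near: t; apply: cvg_within.
    apply: (near_line e (P := fun y => `|x - y| < r / 2)).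
    by apply: (cvgrPdist_lt _ _).1 (@cvg_id _ (nbhs x)) _ _; rewrite divr_gt0.
  - rewrite distrC; near: t; apply: cvg_within.
    apply: (near_line e (P := fun y => `|f x - f y| <= rho / 2)).
    by apply: (cvgrPdist_le _ _).1 fc _ _; rewrite divr_gt0.
pose z u := x + (t *: e + L u).
have zr u : `|u| <= rho -> ball x r (z u).
  move=> urho; rewrite -ball_normE/= opprD addNKr normrN.
  rewrite (le_lt_trans (ler_normD _ _))// (splitr r) ltrD//.
  exact: L_lt.
pose g u := u - (f (z u) - f x).
have g0 : `|g 0| <= rho / 2.
  by rewrite /g /z /L big1 ?addr0 ?sub0r ?normrN// => j _; rewrite mxE scale0r.
have glip u u' : `|u| <= rho -> `|u'| <= rho ->
    `|g u - g u'| <= 2^-1 * `|u - u'|.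
  move=> urho u'rho.
  pose c (s : R) := u' + s *: (u - u').
  have crho s : 0 <= s <= 1 -> `|c s| <= rho.
    move=> /andP[s0 s1]; have -> : c s = (1 - s) *: u' + s *: u.
      by rewrite /c scalerBr scalerBl scale1r addrCA addrC.
    rewrite (le_trans (ler_normD _ _))// !normrZ !ger0_norm ?subr_ge0//.
    have -> : rho = (1 - s) * rho + s * rho by ring.
    by rewrite lerD// ler_wpM2l// subr_ge0.
  pose dh (s : R) := (u - u') - 'd f (z (c s)) (L (u - u')).
  have -> : g u - g u' = (g \o c) 1 - (g \o c) 0.
    by rewrite /= /c scale1r scale0r addr0 [u' + _]addrC subrK.
  apply: (@mean_value_inequality _ _ _ dh).
  - move=> s s01; rewrite /dh.
    have c' : is_derive s 1 c (u - u') by exact: is_derive_line.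
    have zc : z \o c = (fun s => x + t *: e + L u' + s *: L (u - u')).
      apply/funext => q; suff Lc : L (c q) = L u' + q *: L (u - u').
        by rewrite /= /z Lc !addrA.
      apply/eqP; rewrite addrC -subr_eq LB /c addrAC subrr add0r; apply/eqP.
      by rewrite scaler_sumr; apply: eq_bigr => j _; rewrite mxE scalerA.
    have zc' : is_derive s 1 (z \o c) (L (u - u')).
      by rewrite zc; exact: is_derive_line.
    have fzc' := is_derive_comp_diff zc' (df _ (rA _ (zr _ (crho _ s01))).1).
    have -> : g \o c = c - ((f \o (z \o c)) - cst (f x)) by [].
    have fx' : is_derive s 1 (cst (f x)) (0 : 'rV[R]_d) by exact: is_derive_cst.
    by apply: is_derive_eq (is_deriveB c' (is_deriveB fzc' fx')) _; rewrite subr0.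
  - by move=> s /crho/zr zs; exact: dfd.
have [u urho gu] := contraction_ball_fixpoint rho0 g0 glip.
exists (z u); split.
- by have [] := rA _ (zr _ urho).
- apply/negP => /eqP zx.
  have teL : t *: e + L u = 0 by apply: (addrI x); rewrite addr0.
  have u0 : u = 0.
    have := congr1 ('d f x) teL.
    by rewrite linearD linearZ/= dfe scaler0 add0r dfxL linear0.
  move: teL; rewrite u0 -(subrr 0) -LB subrr addr0 => /eqP.
  by rewrite scaler_eq0 (negPf t0) (negPf e0).
- move: gu; rewrite /g => /eqP; rewrite -subr_eq0 addrAC subrr sub0r oppr_eq0 subr_eq0.
  by move=> /eqP.
Unshelve. all: by end_near.
Qed.

(** * Quotients that fold a line *)

(** A relation that identifies [x + t e] with [x - t e] makes the projection even
    along [e], so [e] is killed by its differential at [x]; a submersion would then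
    identify [x] with further points, against the triviality of its class. *)
Lemma folded_not_regular (R : realType) (V : normedModType R) (r : option nat)
    (W : set V) (E : set (V * V)) (x e : V) :
  r <> Some 0%N -> nbhs x W -> e != 0 ->
  (forall z, W z -> E (z, x) -> z = x) ->
  (\forall t \near (0 : R), E (x + t *: e, x + t *: - e)) ->
  ~ regular_quotient r W E.
Proof.
move=> r0 xW e0 Ex fold [Q [pi [d [A [[_ piE] [_ _ [chA covA _]] [cpi subm]]]]]].
have Wx : W x by exact: nbhs_singleton.
have [c Ac cx] := covA (pi x).
have [odom _ _ _ cK] := chA _ Ac.
have [Cf sf] := subm _ Ac.
have [df cdf] := Cr_ge1 r0 Cf.
set D := W `&` _ in df cdf sf; set f := c \o pi in df cdf sf.
have Dx : D x by [].
have xD : nbhs x D.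
  by apply: filterI => //; apply: cpi => //; exact: open_nbhs_nbhs.
have c' v : is_derive (0 : R) 1 (fun t : R => f (x + t *: v)) ('d f x v).
  have := @is_derive_comp_diff _ _ _ _ f _ _ (is_derive_line x v 0).
  by rewrite scale0r addr0; apply; exact: df.
have dfe : 'd f x e = 0.
  have : is_derive (0 : R) 1 (fun t : R => f (x + t *: e)) ('d f x (- e)).
    apply: near_eq_is_derive (c' (- e)).
    near=> t; rewrite /f /=; congr (c _); apply/esym/piE; last by near: t.
      by near: t; exact: near_line.
    by near: t; exact: near_line.
  move=> /@derive_val; rewrite (@derive_val _ _ _ _ _ _ _ (c' e)) linearN => h.
  have : (2 : R) *: 'd f x e = 0 by rewrite scaler_nat mulr2n {1}h addNr.
  by move/eqP; rewrite scaler_eq0 pnatr_eq0 /= => /eqP.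
have [z [[Wz cz] zx fz]] := noninjective_submersion xD df
  (fun v => cdf v x Dx) (sf x Dx) dfe e0.
move/eqP: zx; apply; apply: Ex => //; apply/(piE _ _ Wz Wx).
by rewrite -(cK (pi z)) // -(cK (pi x)) //; congr (chart_inv c _).
Unshelve. all: by end_near.
Qed.

(** * The reflection *)

Lemma nbhs_slab (R : realType) (m : nat) (U : set 'rV[R]_m) (delta : R)
    (b : 'rV[R]_m) (l : R) :
  open U -> U b -> - delta < l < delta ->
  nbhs (b, l) (U `*` [set l : R | - delta < l < delta]).
Proof.
move=> oU Ub ldelta; exists (U, [set l : R | - delta < l < delta]) => //.
split; first exact: open_nbhs_nbhs.
have := @near_in_itvoo R (- delta) delta l; rewrite in_itv/= => /(_ ldelta).
by apply: filterS => u; rewrite in_itv.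
Qed.

Theorem proposition3p2 (R : realType) (m : nat) (U : set 'rV[R]_m) (delta : R)
    (hU : open U) (hdelta : 0 < delta) :
  let M : set ('rV[R]_m * R) := U `*` [set l : R | - delta < l < delta] in
  let F : set ('rV[R]_m * R) := U `*` [set 0 : R] in
  let s : 'rV[R]_m * R -> 'rV[R]_m * R := @reflection R m in
  let E : set (('rV[R]_m * R) * ('rV[R]_m * R)) :=
    (diagonal `&` (M `*` M)) `|` graph_on M s in
  (forall x, F x -> ~ embedded_submanifold_at (Some 1%N) (M `*` M) E (x, x)) /\
  (forall r : option nat, r <> Some 0%N ->
     (forall x, F x -> ~ regular_quotient_at r M E x) /\
     (F !=set0 -> ~ regular_quotient r M E)).
Proof.
move=> M F s E.
have Fx0 x : F x -> x = (x.1, 0) by case: x => b l [_ /= ->].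
have FM x : F x -> nbhs x M.
  by move=> Fx; rewrite (Fx0 _ Fx); apply: nbhs_slab;
    rewrite ?oppr_lt0 ?hdelta //; case: Fx.
pose e : 'rV[R]_m * R := (0, 1).
have e0 : e != 0 by apply/eqP => -[/eqP]; rewrite oner_eq0.
have te t : t *: e = (0, t).
  by rewrite -[LHS]/(t *: 0, t *: 1) scaler0 [_ *: 1]mulr1.
have fold x : F x -> \forall t \near (0 : R), E (x + t *: e, x + t *: - e).
  move=> Fx; have := near_line e (FM x Fx); apply: filterS => t Mt; right; split => //=.
  rewrite (Fx0 _ Fx) scalerN te.
  by congr pair; rewrite /= ?add0r// oppr0.
have EF x z : F x -> E (z, x) -> z = x.
  move=> Fx [[]//|[_ /=]]; rewrite {1}(Fx0 _ Fx) => -[x1 x2].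
  rewrite (Fx0 _ Fx) x1; case: z x2 {x1} => b l /= /eqP.
  by rewrite eq_sym oppr_eq0 => /eqP ->.
split.
  move=> x Fx xE.
  (* the sum of a diagonal and a graph direction is (2e, 0) *)
  have t1 : tangent E (x, x) (e, e).
    exists (fun t : R => (x, x) + t *: (e, e)); split.
    - by rewrite scale0r addr0.
    - by have := near_line e (FM x Fx); apply: filterS => t Mt; left; split.
    - exact: is_derive_line.
  have t2 : tangent E (x, x) (e, - e).
    exists (fun t : R => (x, x) + t *: (e, - e)); split.
    - by rewrite scale0r addr0.
    - exact: fold.
    - exact: is_derive_line.
  have [//|c [c0 Ec c']] := tangentD _ xE t1 t2.
  have d1 : is_derive (0 : R) 1 (fun t => (c t).1.2) 2.
    exact: is_derive_snd (is_derive_fst c').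
  have d2 : is_derive (0 : R) 1 (fun t => (c t).2.2) 0.
    by apply: is_derive_eq (is_derive_snd (is_derive_snd c')) _; exact: subrr.
  have : (2 : R) ^+ 2 = 0 ^+ 2.
    have x0 : x.2 = 0 by case: Fx.
    apply: (eq_sqr_derive d1 d2); rewrite ?c0//.
    apply: filterS Ec => t; case: (c t) => [[b l] [b' l']] /=.
    by case=> [[/= [_ ->]]//|[_ /= [_ ->]]]; rewrite sqrrN.
  by apply/eqP; rewrite expr0n/= expf_eq0/= pnatr_eq0.
have nonreg r W x : r <> Some 0%N -> F x -> nbhs x W -> ~ regular_quotient r W E.
  move=> r0 Fx xW; apply: (folded_not_regular r0 xW e0 _ (fold x Fx)).
  by move=> z _; exact: EF.
move=> r r0; split.
  move=> x Fx [W [oW Wx _ _]]; apply: (nonreg _ _ _ r0 Fx).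
  exact: open_nbhs_nbhs.
by move=> [x Fx]; exact: (nonreg _ _ _ r0 Fx (FM _ Fx)).
Qed.
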